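(* Let $\mathcal{S}(\mathbf{c})=\{\mathbf{c}(\tau)+t(0,1,0):\tau\in I,\ t\in\mathbb{R}\}$ be a cylindrical support surface symmetric about the $yz$-plane. Let $$\Sigma=\{(r\sin s,\,t,\,m+r\cos s): -s_0\le s\le s_0,\ t\in\mathbb{R}\},\qquad r>0,\ m\in\mathbb{R},\ 0<s_0<\pi,$$ be a section of a circular cylinder of radius $r$ which is a capillary surface on $\mathcal{S}(\mathbf{c})$ with contact angle $\gamma\in(0,\pi)$, meeting $\mathcal{S}(\mathbf{c})$ exactly along the two lines $L_{s_0}^{\pm}=\{s=\pm s_0\}$, which pass through the points $\mathbf{c}(\pm\tau_0)$. Let $\mu(\tau_0)=r\kappa(\tau_0)+\delta\cos\gamma$, where $\kappa(\tau_0)$ is the (signed) curvature of $\mathbf{c}$ at the contact points and $\delta=\pm1$ is determined by $A(\nu,\nu)=\delta/r$. 1. If $\mu(\tau_0)\ge 0$, then $\Sigma$ is unstable. 2. Suppose $\mu(\tau_0)<0$, and let $\beta_{1,1}$ be the unique solution in $\left(0,\frac{\pi}{2s_0}\right)$ of $$\tan(\beta s_0)=-\frac{\mu(\tau_0)}{\beta\sin\gamma}.$$ If $\beta_{1,1}<1$, then $\Sigma$ is unstable. Otherwise, $\Sigma$ is strongly stable.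
   Context: Setting. $\mathbf{c}(\tau)=(x(\tau),0,z(\tau))$, $\tau\in I$, is a smooth regular embedded curve in the $xz$-plane, $I$ is an interval symmetric about $0$, and $\mathbf{c}(-\tau)=(-x(\tau),0,z(\tau))$. The surface $\mathcal{S}(\mathbf{c})$ separates $\mathbb{R}^3$ into two domains. A capillary surface $\Sigma$ on $\mathcal{S}(\mathbf{c})$ is a surface of constant mean curvature lying in one of these domains, with $\partial\Sigma\subset\mathcal{S}(\mathbf{c})$, which together with a region of $\mathcal{S}(\mathbf{c})$ bounds a domain $\Omega$ (the fluid), and which makes a constant angle $\gamma$ with $\mathcal{S}(\mathbf{c})$ along $\partial\Sigma$. Here $\cos\gamma=\langle N,\widetilde N\rangle$, where $N$ is the unit normal of $\Sigma$ pointing into $\Omega$ and $\widetilde N$ is the unit normal of $\mathcal{S}(\mathbf{c})$ pointing out of $\Omega$. Curvature signs. $\kappa$ denotes the curvature of $\mathbf{c}$ computed with respect to the unit normal $-\widetilde N$ (so $\kappa=\langle \mathbf{c}'',-\widetilde N\rangle$ if $\mathbf{c}$ is parametrized by arc length). By symmetry $\kappa(-\tau_0)=\kappa(\tau_0)$. $A$ is the second fundamental form of $\Sigma$ with respect to $N$, and $\nu$ is the exterior unit conormal of $\partial\Sigma$ in $\Sigma$. One has $A(\nu,\nu)=1/r$ ($\delta=1$) when $N$ points towards the axis of the cylinder (the fluid is on the side of the axis), and $A(\nu,\nu)=-1/r$ ($\delta=-1$) when $N$ points away from the axis. Stability. Put $$Q[u]=\int_\Sigma\left(|\nabla u|^2-|A|^2u^2\right)d\Sigma-\int_{\partial\Sigma}\mathbf{q}\,u^2\,ds,\qquad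 \mathbf{q}=\frac{\kappa}{\sin\gamma}+\cot\gamma\,A(\nu,\nu).$$ For the present $\Sigma$ one has $|A|^2=1/r^2$ and $\mathbf{q}=\frac{\mu(\tau_0)}{r\sin\gamma}$ on $\partial\Sigma$. The surface $\Sigma$ is stable if $Q[u]\ge0$ for all smooth $u$ on $\Sigma$ (up to the boundary, not required to vanish on $\partial\Sigma$) with compact support and $\int_\Sigma u\,d\Sigma=0$. It is unstable if it is not stable, and strongly stable if $Q[u]\ge 0$ for all smooth compactly supported $u$, without the zero-mean condition. *)

(* Defs.v *)
From Stdlib Require Export Reals ZArith.
From Coquelicot Require Export Coquelicot.
Open Scope R_scope.

(** * Euclidean space *)

Definition R3 : Type := (R * R * R)%type.

Definition co1 (p : R3) : R := fst (fst p).
Definition co2 (p : R3) : R := snd (fst p).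
Definition co3 (p : R3) : R := snd p.

Definition dot (p q : R3) : R := co1 p * co1 q + co2 p * co2 q + co3 p * co3 q.

Definition cross (p q : R3) : R3 :=
  (co2 p * co3 q - co3 p * co2 q,
   co3 p * co1 q - co1 p * co3 q,
   co1 p * co2 q - co2 p * co1 q).

Definition normalize (p : R3) : R3 := scal (/ sqrt (dot p p)) (p : R * R * R).

Definition connected (D : R3 -> Prop) : Prop :=
  forall U V : R3 -> Prop, open U -> open V ->
    (forall p, D p -> U p \/ V p) ->
    (forall p, D p -> ~ (U p /\ V p)) ->
    (forall p, D p -> U p) \/ (forall p, D p -> V p).

Definition domain (D : R3 -> Prop) : Prop :=
  open D /\ connected D /\ exists p, D p.

Definition frontier (D : R3 -> Prop) (p : R3) : Prop :=
  ~ locally p D /\ ~ locally p (fun q => ~ D q).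

(** The vector [v], based at a point [p] of the frontier of [D], points into [D]. *)
Definition points_into (D : R3 -> Prop) (p v : R3) : Prop :=
  exists eps : R, 0 < eps /\
    forall h : R, 0 < h < eps ->
      D (plus p (scal h v)) /\ ~ D (plus p (scal (- h) v)).

(** * The generating curve and the cylinder over it *)

(** The curve is [t |-> (x t, 0, z t)] for [t] in [Iv].  Outside [Iv] the total
    functions [x] and [z] are an auxiliary extension, smooth across endpoints that
    belong to [Iv] and periodic for a closed curve. *)

Definition symmetric_interval (Iv : R -> Prop) : Prop :=
  (forall a b t, Iv a -> Iv b -> a <= t <= b -> Iv t) /\
  (forall t, Iv t -> Iv (- t)).

Definition smooth_on (Iv : R -> Prop) (f : R -> R) : Prop :=
  forall n t, Iv t -> ex_derive_n f n t.

Definition regular_on (Iv : R -> Prop) (x z : R -> R) : Prop :=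
  forall t, Iv t -> Derive x t <> 0 \/ Derive z t <> 0.

(** [T = 0]: the curve is a homeomorphism of [Iv] onto its image.
    [T > 0]: this also admits simple closed curves, traversed with period [T],
    where the parameter is only determined modulo [T]. *)
Definition embedded_on (Iv : R -> Prop) (x z : R -> R) : Prop :=
  exists T : R, 0 <= T /\
    (forall t, x (t + T) = x t /\ z (t + T) = z t) /\
    forall t, Iv t -> forall eps, 0 < eps ->
      exists del, 0 < del /\
        forall s, Iv s -> Rabs (x s - x t) < del -> Rabs (z s - z t) < del ->
          exists k : Z, Rabs (s - t - IZR k * T) < eps.

Definition symmetric_curve (Iv : R -> Prop) (x z : R -> R) : Prop :=
  forall t, Iv t -> x (- t) = - x t /\ z (- t) = z t.

Definition cylinder (Iv : R -> Prop) (x z : R -> R) (p : R3) : Prop :=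
  exists tau t, Iv tau /\ p = (x tau, t, z tau).

(** Unit normal of the cylinder over the curve, at parameter [tau]; [eS = 1] or
    [eS = -1] selects one of the two orientations. *)
Definition support_normal (eS : R) (x z : R -> R) (tau : R) : R3 :=
  scal eS (normalize (- Derive z tau, 0, Derive x tau) : R * R * R).

(** Curvature with respect to [- support_normal]: in an arbitrary regular
    parameter, it is the component of [c''] along that normal over [|c'|^2]. *)
Definition curve_curvature (eS : R) (x z : R -> R) (tau : R) : R :=
  dot (Derive_n x 2 tau, 0, Derive_n z 2 tau)
      (opp (support_normal eS x z tau : R * R * R))
  / ((Derive x tau) ^ 2 + (Derive z tau) ^ 2).

(** * Geometry of a parametrized strip [X : [-s0, s0] x R -> R^3] *)

Definition dS (X : R -> R -> R3) (s t : R) : R3 :=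
  (Derive (fun a => co1 (X a t)) s,
   Derive (fun a => co2 (X a t)) s,
   Derive (fun a => co3 (X a t)) s).

Definition dT (X : R -> R -> R3) (s t : R) : R3 :=
  (Derive (fun b => co1 (X s b)) t,
   Derive (fun b => co2 (X s b)) t,
   Derive (fun b => co3 (X s b)) t).

Definition gE (X : R -> R -> R3) (s t : R) : R := dot (dS X s t) (dS X s t).
Definition gF (X : R -> R -> R3) (s t : R) : R := dot (dS X s t) (dT X s t).
Definition gG (X : R -> R -> R3) (s t : R) : R := dot (dT X s t) (dT X s t).
Definition gdet (X : R -> R -> R3) (s t : R) : R :=
  gE X s t * gG X s t - gF X s t ^ 2.

(** [eN = 1] or [eN = -1] selects the orientation of the strip. *)
Definition unit_normal (eN : R) (X : R -> R -> R3) (s t : R) : R3 :=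
  scal eN (normalize (cross (dS X s t) (dT X s t)) : R * R * R).

Definition hE (eN : R) (X : R -> R -> R3) (s t : R) : R :=
  dot (dS (dS X) s t) (unit_normal eN X s t).
Definition hF (eN : R) (X : R -> R -> R3) (s t : R) : R :=
  dot (dS (dT X) s t) (unit_normal eN X s t).
Definition hG (eN : R) (X : R -> R -> R3) (s t : R) : R :=
  dot (dT (dT X) s t) (unit_normal eN X s t).

(** The second fundamental form on the tangent vector [a X_s + b X_t]. *)
Definition second_ff (eN : R) (X : R -> R -> R3) (s t a b : R) : R :=
  a ^ 2 * hE eN X s t + 2 * a * b * hF eN X s t + b ^ 2 * hG eN X s t.

(** Entries of the shape operator (inverse metric times second fundamental form). *)
Definition W11 (eN : R) (X : R -> R -> R3) (s t : R) : R :=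
  (gG X s t * hE eN X s t - gF X s t * hF eN X s t) / gdet X s t.
Definition W12 (eN : R) (X : R -> R -> R3) (s t : R) : R :=
  (gG X s t * hF eN X s t - gF X s t * hG eN X s t) / gdet X s t.
Definition W21 (eN : R) (X : R -> R -> R3) (s t : R) : R :=
  (gE X s t * hF eN X s t - gF X s t * hE eN X s t) / gdet X s t.
Definition W22 (eN : R) (X : R -> R -> R3) (s t : R) : R :=
  (gE X s t * hG eN X s t - gF X s t * hF eN X s t) / gdet X s t.

Definition mean_curvature (eN : R) (X : R -> R -> R3) (s t : R) : R :=
  (W11 eN X s t + W22 eN X s t) / 2.

Definition norm_sff_sq (eN : R) (X : R -> R -> R3) (s t : R) : R :=
  W11 eN X s t ^ 2 + 2 * W12 eN X s t * W21 eN X s t + W22 eN X s t ^ 2.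

(** The exterior unit conormal on the boundary line [s = s0] ([e = 1]) or
    [s = - s0] ([e = -1]) is [nu = a X_s + b X_t] with [nu] orthogonal to [X_t],
    [|nu| = 1] and [a] of the sign of [e]; this is [A(nu, nu)]. *)
Definition sff_conormal (eN : R) (X : R -> R -> R3) (e s t : R) : R :=
  let a := e * sqrt (gG X s t / gdet X s t) in
  second_ff eN X s t a (- a * gF X s t / gG X s t).

Definition grad_sq (X : R -> R -> R3) (u : R -> R -> R) (s t : R) : R :=
  let us := Derive (fun a => u a t) s in
  let ut := Derive (fun b => u s b) t in
  (gG X s t * us ^ 2 - 2 * gF X s t * us * ut + gE X s t * ut ^ 2) / gdet X s t.

Definition surface_integral (X : R -> R -> R3) (s0 : R) (f : R -> R -> R) : R :=
  RInt_gen (fun t => RInt (fun s => f s t * sqrt (gdet X s t)) (- s0) s0)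
    (Rbar_locally m_infty) (Rbar_locally p_infty).

(** Arc-length integral along the coordinate line of constant first parameter [s]. *)
Definition line_integral (X : R -> R -> R3) (s : R) (f : R -> R) : R :=
  RInt_gen (fun t => f t * sqrt (gG X s t))
    (Rbar_locally m_infty) (Rbar_locally p_infty).

(** Functions on the strip are written in the parameters [(s, t)].  Smooth up to
    the boundary means: restriction to the closed strip of a smooth function on
    the plane; only compactness of the support within the strip is required. *)
Definition test_function (s0 : R) (u : R -> R -> R) : Prop :=
  (forall n s t, ex_diff_n u n s t) /\
  exists T : R, forall s t, - s0 <= s <= s0 -> T < Rabs t -> u s t = 0.

Definition q_coef (gamma kappa Ann : R) : R :=
  kappa / sin gamma + cos gamma / sin gamma * Ann.

(** Second variation; [kp] and [km] are the curvatures of the support curve along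
    the boundary lines [s = s0] and [s = - s0]. *)
Definition Qform (eN : R) (X : R -> R -> R3) (s0 gamma kp km : R)
    (u : R -> R -> R) : R :=
  surface_integral X s0
    (fun s t => grad_sq X u s t - norm_sff_sq eN X s t * u s t ^ 2)
  - (line_integral X s0
       (fun t => q_coef gamma kp (sff_conormal eN X 1 s0 t) * u s0 t ^ 2)
     + line_integral X (- s0)
       (fun t => q_coef gamma km (sff_conormal eN X (-1) (- s0) t)
                 * u (- s0) t ^ 2)).

Definition stable (eN : R) (X : R -> R -> R3) (s0 gamma kp km : R) : Prop :=
  forall u, test_function s0 u -> surface_integral X s0 u = 0 ->
    0 <= Qform eN X s0 gamma kp km u.

Definition unstable (eN : R) (X : R -> R -> R3) (s0 gamma kp km : R) : Prop :=
  ~ stable eN X s0 gamma kp km.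

Definition strongly_stable (eN : R) (X : R -> R -> R3) (s0 gamma kp km : R) : Prop :=
  forall u, test_function s0 u -> 0 <= Qform eN X s0 gamma kp km u.

(** * Capillary surfaces *)

Definition strip_image (X : R -> R -> R3) (s0 : R) (p : R3) : Prop :=
  exists s t, - s0 <= s <= s0 /\ p = X s t.

(** [D] is the side of the support surface containing the capillary surface and
    [Omega] the fluid.  Since [Omega] is a domain in [D] whose frontier lies in
    the union of the two surfaces, it is a component of the complement of the
    strip in [D].  The direction of the normal of the strip is tested at its
    interior points and that of the support normal at wetted points off the
    contact lines; on the contact lines both are given by continuity. *)
Record capillary (Iv : R -> Prop) (x z : R -> R) (X : R -> R -> R3)
    (s0 gamma eN eS : R) (D Omega : R3 -> Prop) : Prop := {
  cap_eN : eN = 1 \/ eN = -1;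
  cap_eS : eS = 1 \/ eS = -1;
  cap_cmc : exists H, forall s t, - s0 <= s <= s0 -> mean_curvature eN X s t = H;
  cap_separates : exists D' : R3 -> Prop,
    domain D /\ domain D' /\ (forall p, ~ (D p /\ D' p)) /\
    (forall p, ~ cylinder Iv x z p <-> D p \/ D' p);
  cap_inside : forall s t, - s0 < s < s0 -> D (X s t);
  cap_boundary : forall s t, s = s0 \/ s = - s0 -> cylinder Iv x z (X s t);
  cap_fluid : domain Omega /\ (forall p, Omega p -> D p);
  cap_frontier : exists W : R3 -> Prop,
    (forall p, W p -> cylinder Iv x z p) /\
    (forall p, frontier Omega p <-> strip_image X s0 p \/ W p);
  cap_normal : forall s t, - s0 < s < s0 ->
    points_into Omega (X s t) (unit_normal eN X s t);
  cap_support_normal : forall tau t, Iv tau ->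
    frontier Omega (x tau, t, z tau) -> ~ strip_image X s0 (x tau, t, z tau) ->
    points_into Omega (x tau, t, z tau)
      (opp (support_normal eS x z tau : R * R * R));
  cap_angle : forall s t tau b, s = s0 \/ s = - s0 -> Iv tau ->
    X s t = (x tau, b, z tau) ->
    dot (unit_normal eN X s t) (support_normal eS x z tau) = cos gamma
}.

Definition circular_section (r m s t : R) : R3 := (r * sin s, t, m + r * cos s).

(* Main.v *)
Require Import Defs.
From Stdlib Require Import Lra FunctionalExtensionality.

(** For [u = u(s, t)] the second variation is
      [int int ((u_s^2 - u^2) / r + r u_t^2) ds dt
         - (kappa / r) int (u(s0, t)^2 + u(- s0, t)^2) dt],  [kappa = mu / sin gamma];
    both contact lines carry the same coefficient because reflecting the curve
    preserves its curvature.  If [f(s) = cos (b s)] makes the one-dimensional form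
    [int (f'^2 - f^2) ds - kappa (f(s0)^2 + f(- s0)^2)] negative, then
    [f(s) phi(e t)], with [phi] an odd bump and [e] small, has zero mean and negative
    second variation: stretching in [t] makes the [u_t^2] term negligible.  The form is
    negative for [b = 0] when [mu >= 0], and for [b = beta] when [mu < 0] and
    [beta < 1].  When [beta >= 1], completing the square with
    [w = beta tan (beta s)], the negative of the logarithmic derivative of
    [cos (beta s)], shows that the form is nonnegative. *)

(** * Integrals and one-sided derivatives *)

Lemma continuity_2d_pt_slice_l (u : R -> R -> R) (s t : R) :
  continuity_2d_pt u s t -> continuous (fun a => u a t) s.
Proof.
  intros H; apply filterlim_locally; intros eps.
  destruct (H eps) as [d Hd]; exists d; intros a Ha.
  apply Hd; [exact Ha | rewrite Rminus_eq_0, Rabs_R0; apply cond_pos].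
Qed.

Lemma continuity_2d_pt_slice_r (u : R -> R -> R) (s t : R) :
  continuity_2d_pt u s t -> continuous (fun b => u s b) t.
Proof.
  intros H; apply filterlim_locally; intros eps.
  destruct (H eps) as [d Hd]; exists d; intros b Hb.
  apply Hd; [rewrite Rminus_eq_0, Rabs_R0; apply cond_pos | exact Hb].
Qed.

(** Uniform continuity along the compact segment [[a, b] x {c}] bounds the increment of the
    integrand by [eps / (b - a + 1)]; the added 1 keeps the final bound strict and covers
    [a = b]. *)
Lemma continuous_RInt_param (f : R -> R -> R) (a b c : R) :
  a <= b -> (forall s t, continuity_2d_pt f s t) ->
  continuous (fun t => RInt (fun s => f s t) a b) c.
Proof.
  intros Hab Hf; apply filterlim_locally; intros eps.
  assert (He : 0 < eps / (b - a + 1)).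
  { apply Rdiv_lt_0_compat; [apply cond_pos | lra]. }
  destruct (uniform_continuity_2d_1d f a b c (fun s _ => Hf s c) (mkposreal _ He))
    as [d Hd]; simpl in Hd.
  assert (Hex : forall t, ex_RInt (fun s => f s t) a b).
  { intros t; apply (ex_RInt_continuous (V := R_CompleteNormedModule)); intros s _.
    apply continuity_2d_pt_slice_l, Hf. }
  exists d; intros t Ht.
  change (Rabs (RInt (fun s => f s t) a b - RInt (fun s => f s c) a b) < eps).
  change (Rabs (t - c) < d) in Ht; apply Rabs_lt_between in Ht.
  assert (E : RInt (fun s => f s t) a b - RInt (fun s => f s c) a b
              = RInt (fun s => f s t - f s c) a b).
  { symmetry; apply (RInt_minus (fun s => f s t) (fun s => f s c) a b); apply Hex. }
  rewrite E.
  apply Rle_lt_trans with ((b - a) * (eps / (b - a + 1))).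
  - apply abs_RInt_le_const; [exact Hab | |].
    + apply @ex_RInt_minus; apply Hex.
    + intros s Hs; pose proof (cond_pos d); left; apply (Hd s c s t); try lra.
      rewrite Rminus_eq_0, Rabs_R0; apply cond_pos.
  - pose proof (cond_pos eps).
    apply Rmult_lt_reg_r with (b - a + 1); [lra |].
    replace ((b - a) * (eps / (b - a + 1)) * (b - a + 1)) with ((b - a) * eps)
      by (field; lra).
    nra.
Qed.

Lemma is_RInt_zero (f : R -> R) (a b : R) :
  (forall t, Rmin a b < t < Rmax a b -> f t = 0) -> is_RInt f a b 0.
Proof.
  intros Hf; apply (is_RInt_ext (fun _ => 0)); [intros t Ht; symmetry; auto |].
  pose proof (is_RInt_const (V := R_NormedModule) a b 0) as Hc.
  change (is_RInt (fun _ => 0) a b ((b - a) * 0)) in Hc.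
  rewrite Rmult_0_r in Hc; exact Hc.
Qed.

(** Once [a < - T] and [T < b], the integral over [[a, b]] already equals [l], so the limit is that
    of an eventually constant function. *)
Lemma RInt_gen_compact_support (f : R -> R) (T l : R) :
  (forall t, T < Rabs t -> f t = 0) -> is_RInt f (- T) T l -> 0 <= T ->
  RInt_gen f (Rbar_locally m_infty) (Rbar_locally p_infty) = l.
Proof.
  intros H0 Hl HT; apply is_RInt_gen_unique; intros P HP.
  apply Filter_prod with (fun a => a < - T) (fun b => T < b);
    [exists (- T); auto | exists T; auto |].
  intros a b Ha Hb; exists l; split; [| exact (locally_singleton _ _ HP)].
  assert (Hz : forall c d, (d <= - T /\ c <= d) \/ (T <= c /\ c <= d) ->
    is_RInt f c d 0).
  { intros c d Hcd; apply is_RInt_zero; intros t Ht.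
    rewrite Rmin_left, Rmax_right in Ht by lra.
    apply H0; destruct Hcd; [rewrite Rabs_left | rewrite Rabs_right]; lra. }
  simpl; replace l with (0 + l + 0) by ring.
  apply (is_RInt_Chasles (V := R_NormedModule) f a T b (0 + l) 0);
    [apply (is_RInt_Chasles (V := R_NormedModule) f a (- T) T 0 l) |];
    auto; apply Hz; lra.
Qed.

(** No neighbourhood of [a] is needed, so this applies at the end of an interval. *)
Lemma is_derive_eq_on_segment (f g : R -> R) (a b lf lg : R) :
  a <> b -> (forall t, Rmin a b <= t <= Rmax a b -> f t = g t) ->
  is_derive f a lf -> is_derive g a lg -> lf = lg.
Proof.
  intros Hab Hfg Hf Hg.
  assert (H : is_derive (fun t => f t - g t) a (lf - lg)).
  { apply @is_derive_minus; assumption. }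
  apply is_derive_Reals in H.
  destruct (Req_dec lf lg) as [|Hne]; [assumption | exfalso].
  assert (He : 0 < Rabs (lf - lg)) by (apply Rabs_pos_lt; lra).
  destruct (H _ He) as [d Hd].
  assert (Hba : 0 < Rabs (b - a)) by (apply Rabs_pos_lt; lra).
  pose proof (cond_pos d) as Hdp.
  (* The increment [k * (b - a)] stays in the segment, as [k <= 1 / 2], and has size below [d]. The
     difference quotient of [f - g] is 0 there, so the derivative estimate reads
     [|lf - lg| < |lf - lg|]. *)
  set (k := Rmin (1 / 2) (d / (2 * Rabs (b - a)))).
  assert (Hk : 0 < k).
  { apply Rmin_pos; [lra | apply Rdiv_lt_0_compat; lra]. }
  assert (Hk1 : k <= 1 / 2) by apply Rmin_l.
  assert (Hk2 : k * Rabs (b - a) < d).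
  { apply Rle_lt_trans with (d / (2 * Rabs (b - a)) * Rabs (b - a)).
    - apply Rmult_le_compat_r; [lra | apply Rmin_r].
    - replace (d / (2 * Rabs (b - a)) * Rabs (b - a)) with (d / 2) by (field; lra).
      lra. }
  assert (Hh : k * (b - a) <> 0) by (apply Rmult_integral_contrapositive; lra).
  specialize (Hd (k * (b - a)) Hh).
  rewrite Rabs_mult, (Rabs_right k) in Hd by lra.
  specialize (Hd Hk2).
  rewrite !Hfg in Hd.
  - rewrite !Rminus_eq_0 in Hd.
    replace (0 / (k * (b - a)) - (lf - lg)) with (- (lf - lg)) in Hd by (field; lra).
    rewrite Rabs_Ropp in Hd; lra.
  - split; [apply Rmin_l | apply Rmax_l].
  - unfold Rmin, Rmax; destruct (Rle_dec a b); nra.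
Qed.

(** The difference quotient at 0 is at most [C * |h|] in absolute value. This gives the derivative
    of the flat functions at the point where their two pieces meet. *)
Lemma is_derive_quadratic_bound (f : R -> R) (C : R) :
  (forall t, Rabs (f t) <= C * t ^ 2) -> is_derive f 0 0.
Proof.
  intros Hf.
  assert (HC : 0 <= C).
  { specialize (Hf 1); pose proof (Rabs_pos (f 1)); lra. }
  assert (H0 : f 0 = 0).
  { specialize (Hf 0); apply Rabs_eq_0; pose proof (Rabs_pos (f 0)); nra. }
  apply is_derive_Reals; intros eps He.
  assert (Hd : 0 < eps / (C + 1)) by (apply Rdiv_lt_0_compat; lra).
  exists (mkposreal _ Hd); simpl; intros h Hh Hhd.
  rewrite Rplus_0_l, H0.
  replace ((f h - 0) / h - 0) with (f h / h) by (field; exact Hh).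
  pose proof (Rabs_pos_lt h Hh) as Hp.
  unfold Rdiv; rewrite Rabs_mult, Rabs_inv.
  apply Rmult_lt_reg_r with (Rabs h); [exact Hp |].
  rewrite Rmult_assoc, Rinv_l, Rmult_1_r by lra.
  apply Rle_lt_trans with (C * h ^ 2); [apply Hf |].
  rewrite <- (pow2_abs h).
  assert (Rabs h * (C + 1) < eps).
  { apply Rmult_lt_reg_r with (/ (C + 1)); [apply Rinv_0_lt_compat; lra |].
    rewrite Rmult_assoc, Rinv_r, Rmult_1_r by lra; exact Hhd. }
  nra.
Qed.

Lemma ex_RInt_continuous_R (f : R -> R) (a b : R) :
  (forall t, continuous f t) -> ex_RInt f a b.
Proof.
  intros Hf; apply (ex_RInt_continuous (V := R_CompleteNormedModule)); auto.
Qed.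

Lemma is_RInt_lin (f g : R -> R) (a b c d lf lg : R) :
  is_RInt f a b lf -> is_RInt g a b lg ->
  is_RInt (fun t => c * f t + d * g t) a b (c * lf + d * lg).
Proof.
  intros Hf Hg.
  apply (is_RInt_plus (V := R_NormedModule)); apply (is_RInt_scal (V := R_NormedModule));
    assumption.
Qed.

Lemma is_RInt_rescale (f : R -> R) (e l : R) :
  0 < e -> is_RInt f (- 1) 1 l -> is_RInt (fun t => f (e * t)) (- / e) (/ e) (/ e * l).
Proof.
  intros He Hf.
  apply (is_RInt_ext (fun t => scal (/ e) (scal e (f (e * t + 0))))).
  - intros t _; unfold scal; simpl; unfold mult; simpl.
    rewrite Rplus_0_r; field; lra.
  - apply (is_RInt_scal (V := R_NormedModule)).
    apply (is_RInt_comp_lin (V := R_NormedModule) f e 0).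
    replace (e * - / e + 0) with (- 1) by (field; lra).
    replace (e * / e + 0) with 1 by (field; lra).
    exact Hf.
Qed.

Lemma RInt_odd (f : R -> R) (T : R) :
  (forall t, continuous f t) -> (forall t, f (- t) = - f t) -> RInt f (- T) T = 0.
Proof.
  intros Hc Hodd.
  pose proof (RInt_correct f (- T) T (ex_RInt_continuous_R f (- T) T Hc)) as H.
  set (l := RInt f (- T) T) in *.
  assert (H' : is_RInt f (- T) T (- l)).
  { apply (is_RInt_ext (fun y => opp (f (- y)))).
    - intros y _; rewrite Hodd; apply Ropp_involutive.
    - apply (is_RInt_comp_opp (V := R_NormedModule) f (- T) T).
      rewrite Ropp_involutive; apply (is_RInt_swap (V := R_NormedModule)), H. }
  apply (is_RInt_unique (V := R_CompleteNormedModule)) in H'; fold l in H'; lra.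
Qed.

(** * Smooth bump functions *)

(** [flat 0] is the classical smooth, non-analytic function [exp (- 1 / t)] extended by 0. The
    powers of [1 / t] are included so that derivatives stay in the linear span of the family. *)
Definition flat (n : nat) (t : R) : R :=
  if Rlt_dec 0 t then (/ t) ^ n * exp (- / t) else 0.

Lemma flat_pos_eq (n : nat) (t : R) : 0 < t -> flat n t = (/ t) ^ n * exp (- / t).
Proof. intros Ht; unfold flat; destruct (Rlt_dec 0 t); lra. Qed.

Lemma flat_nonpos (n : nat) (t : R) : t <= 0 -> flat n t = 0.
Proof. intros Ht; unfold flat; destruct (Rlt_dec 0 t); lra. Qed.

(** [y ^ n / n!] is one of the nonnegative terms of a Taylor sum that [exp y] dominates. *)
Lemma pow_le_fact_exp (n : nat) (y : R) : 0 <= y -> y ^ n <= INR (fact n) * exp y.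
Proof.
  intros Hy; pose proof (INR_fact_lt_0 n) as Hn.
  apply Rmult_le_reg_l with (/ INR (fact n)); [apply Rinv_0_lt_compat, Hn |].
  rewrite <- Rmult_assoc, Rinv_l, Rmult_1_l, Rmult_comm by lra.
  apply Rle_trans with (sum_f_R0 (fun k => y ^ k / INR (fact k)) n);
    [| apply exp_ge_taylor, Hy].
  destruct n as [|n]; [right; reflexivity |].
  rewrite tech5.
  assert (0 <= sum_f_R0 (fun k => y ^ k / INR (fact k)) n).
  { apply cond_pos_sum; intros k.
    apply Rmult_le_pos; [apply pow_le, Hy |].
    left; apply Rinv_0_lt_compat, INR_fact_lt_0. }
  unfold Rdiv in *; lra.
Qed.

(** Bounding [y ^ (n + 2)] by the exponential at [y = 1 / t] leaves two spare powers, which become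
    [t ^ 2]: enough for a zero derivative at 0, for every [n]. *)
Lemma flat_bound (n : nat) (t : R) :
  Rabs (flat n t) <= INR (fact (n + 2)) * t ^ 2.
Proof.
  pose proof (INR_fact_lt_0 (n + 2)) as HF.
  destruct (Rlt_dec 0 t) as [Ht | Ht].
  - rewrite flat_pos_eq by exact Ht.
    pose proof (Rinv_0_lt_compat _ Ht) as Hi.
    pose proof (exp_pos (- / t)) as He.
    rewrite Rabs_right by (apply Rle_ge, Rmult_le_pos; [apply pow_le |]; lra).
    pose proof (pow_le_fact_exp (n + 2) (/ t) (Rlt_le _ _ Hi)) as Hb.
    rewrite pow_add in Hb.
    apply (Rmult_le_compat_r (exp (- / t) * t ^ 2)) in Hb; [| nra].
    replace ((/ t) ^ n * (/ t) ^ 2 * (exp (- / t) * t ^ 2))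
      with ((/ t) ^ n * exp (- / t)) in Hb
      by (rewrite (pow_inv t 2); field; lra).
    replace (INR (fact (n + 2)) * exp (/ t) * (exp (- / t) * t ^ 2))
      with (INR (fact (n + 2)) * t ^ 2 * (exp (/ t) * exp (- / t))) in Hb by ring.
    rewrite <- exp_plus, Rplus_opp_r, exp_0 in Hb; lra.
  - rewrite flat_nonpos, Rabs_R0 by lra; nra.
Qed.

Lemma is_derive_flat (n : nat) (t : R) :
  is_derive (flat n) t (flat (S (S n)) t - INR n * flat (S n) t).
Proof.
  destruct (Rtotal_order t 0) as [Ht | [-> | Ht]].
  - rewrite !flat_nonpos by lra; rewrite Rmult_0_r, Rminus_0_r.
    apply (is_derive_ext_loc (fun _ => 0)); [| apply @is_derive_const].
    assert (Hd : 0 < - t) by lra.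
    exists (mkposreal _ Hd); intros y Hy.
    change (Rabs (y - t) < - t) in Hy; apply Rabs_lt_between in Hy.
    symmetry; apply flat_nonpos; lra.
  - rewrite !flat_nonpos by lra; rewrite Rmult_0_r, Rminus_0_r.
    exact (is_derive_quadratic_bound _ _ (flat_bound n)).
  - apply (is_derive_ext_loc (fun y => (/ y) ^ n * exp (- / y))).
    + exists (mkposreal _ Ht); intros y Hy.
      change (Rabs (y - t) < t) in Hy; apply Rabs_lt_between in Hy.
      symmetry; apply flat_pos_eq; lra.
    + rewrite !flat_pos_eq by exact Ht.
      auto_derive; [lra |].
      destruct n as [|n]; [| rewrite S_INR]; simpl pred; simpl; field; lra.
Qed.

(** A class closed under differentiation, so that smoothness of every order follows from first
    derivatives alone. It contains cosines and bumps of any frequency and scale. *)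
Inductive elementary : (R -> R) -> Prop :=
| elementary_const c : elementary (fun _ => c)
| elementary_id : elementary (fun t => t)
| elementary_cos : elementary cos
| elementary_sin : elementary sin
| elementary_flat n : elementary (flat n)
| elementary_plus f g : elementary f -> elementary g -> elementary (fun t => f t + g t)
| elementary_mult f g : elementary f -> elementary g -> elementary (fun t => f t * g t)
| elementary_comp f g : elementary f -> elementary g -> elementary (fun t => f (g t)).

Lemma elementary_derive (f : R -> R) :
  elementary f -> exists df, elementary df /\ forall t, is_derive f t (df t).
Proof.
  induction 1 as [c | | | | n
    | f g Hf [df [Hdf If]] Hg [dg [Hdg Ig]]
    | f g Hf [df [Hdf If]] Hg [dg [Hdg Ig]]
    | f g Hf [df [Hdf If]] Hg [dg [Hdg Ig]]].
  - exists (fun _ => 0); split; [constructor | intros t; apply @is_derive_const].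
  - exists (fun _ => 1); split; [constructor | intros t; apply @is_derive_id].
  - exists (fun t => -1 * sin t); split; [apply elementary_mult; constructor |].
    intros t; auto_derive; [exact I | ring].
  - exists cos; split; [constructor |].
    intros t; auto_derive; [exact I | ring].
  - exists (fun t => flat (S (S n)) t + (- INR n) * flat (S n) t).
    split; [apply elementary_plus; [| apply elementary_mult]; constructor |].
    intros t; replace (_ + _) with (flat (S (S n)) t - INR n * flat (S n) t) by ring.
    apply is_derive_flat.
  - exists (fun t => df t + dg t); split; [constructor; assumption |].
    intros t; apply @is_derive_plus; auto.
  - exists (fun t => df t * g t + f t * dg t).
    split; [apply elementary_plus; apply elementary_mult; assumption |].
    intros t; apply (is_derive_mult f g t (df t) (dg t)); auto.
    intros; apply Rmult_comm.
  - exists (fun t => dg t * df (g t)).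
    split; [apply elementary_mult; [| apply elementary_comp]; assumption |].
    intros t; apply (is_derive_comp f g); auto.
Qed.

Lemma elementary_continuous (f : R -> R) (t : R) : elementary f -> continuous f t.
Proof.
  intros Hf; destruct (elementary_derive f Hf) as [df [_ Hd]].
  apply @ex_derive_continuous; exists (df t); apply Hd.
Qed.

(** Both partial derivatives of a separated product are again separated products of elementary
    functions, so the induction on [n] runs over all [f] and [g] at once. *)
Lemma elementary_ex_diff_n (f g : R -> R) (n : nat) (s t : R) :
  elementary f -> elementary g -> ex_diff_n (fun a b => f a * g b) n s t.
Proof.
  revert f g; induction n as [|n IH]; intros f g Hf Hg.
  all: assert (Hc : continuity_2d_pt (fun a b => f a * g b) s t).
  1, 3: apply continuity_2d_pt_mult;
    [ apply (continuity_1d_2d_pt_comp f (fun a _ => a));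
        [apply continuity_pt_filterlim, elementary_continuous, Hf
        | apply continuity_2d_pt_id1]
    | apply (continuity_1d_2d_pt_comp g (fun _ b => b));
        [apply continuity_pt_filterlim, elementary_continuous, Hg
        | apply continuity_2d_pt_id2] ].
  - split; [exact Hc | exact I].
  - destruct (elementary_derive f Hf) as [df [Hdf If]].
    destruct (elementary_derive g Hg) as [dg [Hdg Ig]].
    assert (D1 : forall a b, is_derive (fun z => f z * g b) a (df a * g b)).
    { intros a b; apply (is_derive_ext (fun z => g b * f z)); [intros; apply Rmult_comm |].
      rewrite Rmult_comm; apply is_derive_scal, If. }
    assert (D2 : forall a b, is_derive (fun z => f a * g z) b (f a * dg b)).
    { intros a b; apply is_derive_scal, Ig. }
    simpl; split; [exact Hc |].
    split; [eexists; apply D1 | split; [eexists; apply D2 | split]].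
    + replace (fun u v => Derive (fun z => f z * g v) u) with (fun a b => df a * g b).
      * apply IH; assumption.
      * do 2 (apply functional_extensionality; intro).
        symmetry; apply is_derive_unique, D1.
    + replace (fun u v => Derive (fun z => f u * g z) v) with (fun a b => f a * dg b).
      * apply IH; assumption.
      * do 2 (apply functional_extensionality; intro).
        symmetry; apply is_derive_unique, D2.
Qed.

(** The flat factors confine the support to [[-1, 1]]; the factor [y] makes the bump odd, which
    later gives zero mean. The form [-1 * y] fits the constructors of [elementary]. *)
Definition odd_bump (y : R) : R := y * (flat 0 (1 + y) * flat 0 (1 + -1 * y)).

Lemma odd_bump_elementary : elementary odd_bump.
Proof.
  unfold odd_bump; apply elementary_mult; [constructor | apply elementary_mult].
  - apply (elementary_comp (flat 0)); [| apply elementary_plus]; constructor.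
  - apply (elementary_comp (flat 0));
      [| apply elementary_plus; [| apply elementary_mult]]; constructor.
Qed.

Lemma odd_bump_opp (y : R) : odd_bump (- y) = - odd_bump y.
Proof.
  unfold odd_bump.
  replace (1 + -1 * - y) with (1 + y) by ring.
  replace (1 + -1 * y) with (1 + - y) by ring; ring.
Qed.

Lemma odd_bump_support (y : R) : 1 <= Rabs y -> odd_bump y = 0.
Proof.
  intros Hy; unfold odd_bump.
  destruct (Rle_dec 0 y).
  - rewrite Rabs_right in Hy by lra; rewrite (flat_nonpos 0 (1 + -1 * y)) by lra; ring.
  - rewrite Rabs_left in Hy by lra; rewrite (flat_nonpos 0 (1 + y)) by lra; ring.
Qed.

Lemma odd_bump_sq_integral_pos : 0 < RInt (fun y => odd_bump y ^ 2) (- 1) 1.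
Proof.
  assert (Hc : forall y, continuous (fun y => odd_bump y ^ 2) y).
  { intros y; apply elementary_continuous.
    apply (elementary_mult odd_bump (fun y => odd_bump y * 1));
      [| apply elementary_mult; [| constructor]]; apply odd_bump_elementary. }
  assert (Hex : forall a b, ex_RInt (fun y => odd_bump y ^ 2) a b)
    by (intros; apply ex_RInt_continuous_R, Hc).
  (* The bump vanishes at 0, so strict positivity is used on [(0, 1)] only. *)
  rewrite <- (RInt_Chasles (fun y => odd_bump y ^ 2) (- 1) 0 1) by apply Hex.
  assert (0 <= RInt (fun y => odd_bump y ^ 2) (- 1) 0).
  { apply RInt_ge_0; [lra | apply Hex | intros; apply pow2_ge_0]. }
  assert (0 < RInt (fun y => odd_bump y ^ 2) 0 1).
  { apply RInt_gt_0; [lra | | intros; apply Hc].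
    intros y Hy; apply pow2_gt_0; unfold odd_bump.
    rewrite !flat_pos_eq by lra; rewrite !pow_O, !Rmult_1_l.
    pose proof (exp_pos (- / (1 + y))); pose proof (exp_pos (- / (1 + -1 * y))).
    apply Rgt_not_eq; repeat apply Rmult_lt_0_compat; lra. }
  apply Rplus_le_lt_0_compat; assumption.
Qed.

(** * Circular sections *)

Lemma circular_section_dS (r m : R) :
  dS (circular_section r m) = fun s _ => (r * cos s, 0, - (r * sin s)).
Proof.
  do 2 (apply functional_extensionality; intro).
  unfold dS, circular_section, co1, co2, co3; simpl.
  f_equal; [f_equal |]; apply is_derive_unique; auto_derive; auto; ring.
Qed.

Lemma circular_section_dT (r m : R) :
  dT (circular_section r m) = fun _ _ => (0, 1, 0).
Proof.
  do 2 (apply functional_extensionality; intro).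
  unfold dT, circular_section, co1, co2, co3; simpl.
  f_equal; [f_equal |]; apply is_derive_unique; auto_derive; auto; ring.
Qed.

Lemma circular_section_metric (r m s t : R) :
  gE (circular_section r m) s t = r ^ 2 /\ gF (circular_section r m) s t = 0 /\
  gG (circular_section r m) s t = 1 /\ gdet (circular_section r m) s t = r ^ 2.
Proof.
  assert (HE : gE (circular_section r m) s t = r ^ 2).
  { unfold gE; rewrite circular_section_dS; unfold dot, co1, co2, co3; simpl.
    pose proof (sin2_cos2 s) as H; unfold Rsqr in H; nra. }
  assert (HF : gF (circular_section r m) s t = 0).
  { unfold gF; rewrite circular_section_dS, circular_section_dT.
    unfold dot, co1, co2, co3; simpl; ring. }
  assert (HG : gG (circular_section r m) s t = 1).
  { unfold gG; rewrite circular_section_dT; unfold dot, co1, co2, co3; simpl; ring. }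
  unfold gdet; rewrite HE, HF, HG; repeat split; ring.
Qed.

(** The rulings are straight, so the only nonzero entry of the shape operator is [W11 = - eN / r],
    and squaring removes the orientation. *)
Lemma circular_section_norm_sff_sq (r m eN s t : R) :
  0 < r -> eN = 1 \/ eN = -1 ->
  norm_sff_sq eN (circular_section r m) s t = / r ^ 2.
Proof.
  intros Hr HN.
  assert (HF : hF eN (circular_section r m) s t = 0).
  { unfold hF; rewrite circular_section_dT.
    unfold dS, dot, co1, co2, co3; simpl; rewrite !Derive_const; ring. }
  assert (HG : hG eN (circular_section r m) s t = 0).
  { unfold hG; rewrite circular_section_dT.
    unfold dT, dot, co1, co2, co3; simpl; rewrite !Derive_const; ring. }
  assert (HE : hE eN (circular_section r m) s t = - eN * r).
  { unfold hE, unit_normal; rewrite circular_section_dT, !circular_section_dS.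
    unfold normalize, cross, dS, dot, co1, co2, co3, scal; simpl.
    unfold prod_scal, scal; simpl; unfold mult; simpl.
    replace (Derive (fun a => r * cos a) s) with (- (r * sin s))
      by (symmetry; apply is_derive_unique; auto_derive; auto; ring).
    replace (Derive (fun a => - (r * sin a)) s) with (- (r * cos s))
      by (symmetry; apply is_derive_unique; auto_derive; auto; ring).
    pose proof (sin2_cos2 s) as Hsc; unfold Rsqr in Hsc.
    match goal with |- context [sqrt ?e] => replace e with (r * r) by nra end.
    rewrite sqrt_square by lra.
    transitivity (- eN * r * (sin s * sin s + cos s * cos s)); [field; lra |].
    rewrite Hsc; ring. }
  destruct (circular_section_metric r m s t) as [GE [GF [GG GD]]].
  unfold norm_sff_sq, W11, W12, W21, W22; rewrite HE, HF, HG, GE, GF, GG, GD.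
  destruct HN as [-> | ->]; field; lra.
Qed.

Lemma circular_section_surface_integral (r m s0 : R) (f : R -> R -> R) :
  0 < r ->
  surface_integral (circular_section r m) s0 f =
  RInt_gen (fun t => RInt (fun s => f s t * r) (- s0) s0)
    (Rbar_locally m_infty) (Rbar_locally p_infty).
Proof.
  intros Hr; unfold surface_integral; f_equal.
  apply functional_extensionality; intros t; f_equal.
  apply functional_extensionality; intros s; f_equal.
  destruct (circular_section_metric r m s t) as [_ [_ [_ ->]]].
  apply sqrt_pow2; lra.
Qed.

Lemma circular_section_line_integral (r m s : R) (f : R -> R) :
  line_integral (circular_section r m) s f =
  RInt_gen f (Rbar_locally m_infty) (Rbar_locally p_infty).
Proof.
  unfold line_integral; f_equal.
  apply functional_extensionality; intros t.
  destruct (circular_section_metric r m s t) as [_ [_ [-> _]]].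
  rewrite sqrt_1; ring.
Qed.

(** * The second variation in coordinates, instability and strong stability *)

Definition Qdensity (r : R) (u : R -> R -> R) (s t : R) : R :=
  (Derive (fun a => u a t) s ^ 2 - u s t ^ 2) / r
  + r * Derive (fun b => u s b) t ^ 2.

(** The area factor [r] turns [u_s^2 / r^2 + u_t^2 - u^2 / r^2] into [Qdensity], and [q] is [q_coef]
    evaluated at [A(nu, nu) = delta / r]. *)
Lemma circular_section_Qform (r m s0 gamma eN delta k : R) (u : R -> R -> R) :
  0 < r -> 0 < gamma < PI -> eN = 1 \/ eN = -1 ->
  (forall t, sff_conormal eN (circular_section r m) 1 s0 t = delta / r /\
             sff_conormal eN (circular_section r m) (-1) (- s0) t = delta / r) ->
  let q := (r * k + delta * cos gamma) / sin gamma / r in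
  Qform eN (circular_section r m) s0 gamma k k u =
  RInt_gen (fun t => RInt (fun s => Qdensity r u s t) (- s0) s0)
    (Rbar_locally m_infty) (Rbar_locally p_infty)
  - (RInt_gen (fun t => q * u s0 t ^ 2) (Rbar_locally m_infty) (Rbar_locally p_infty)
     + RInt_gen (fun t => q * u (- s0) t ^ 2)
         (Rbar_locally m_infty) (Rbar_locally p_infty)).
Proof.
  intros Hr Hg HN HA q.
  assert (Hsin : 0 < sin gamma) by (apply sin_gt_0; lra).
  unfold Qform; rewrite circular_section_surface_integral by exact Hr.
  rewrite !circular_section_line_integral.
  f_equal; [f_equal | f_equal; f_equal]; apply functional_extensionality; intros t.
  - f_equal; apply functional_extensionality; intros s.
    unfold Qdensity, grad_sq; rewrite circular_section_norm_sff_sq by assumption.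
    destruct (circular_section_metric r m s t) as [-> [-> [-> ->]]].
    field; lra.
  - rewrite (proj1 (HA t)); unfold q_coef, q; field; lra.
  - rewrite (proj2 (HA t)); unfold q_coef, q; field; lra.
Qed.

(** Since [u] is known to vanish only within the closed strip, its [s]-derivative on the lines
    [s = s0] and [s = - s0] has to be read off from one side. *)
Lemma Qdensity_support (r s0 T : R) (u : R -> R -> R) :
  0 < s0 -> 0 <= T -> (forall n s t, ex_diff_n u n s t) ->
  (forall s t, - s0 <= s <= s0 -> T < Rabs t -> u s t = 0) ->
  forall s t, - s0 <= s <= s0 -> T < Rabs t -> Qdensity r u s t = 0.
Proof.
  intros Hs0 HT Hsm Hu s t Hs Ht.
  destruct (Hsm 1%nat s t) as [_ [D1 [D2 _]]].
  assert (Z : forall y, is_derive (fun _ : R => 0) y 0)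
    by (intros; apply @is_derive_const).
  assert (E1 : Derive (fun a => u a t) s = 0).
  { apply (is_derive_eq_on_segment (fun a => u a t) (fun _ => 0) s
      (if Rle_dec s 0 then s0 else - s0)).
    - destruct (Rle_dec s 0); lra.
    - intros a Ha; apply Hu; [| exact Ht].
      unfold Rmin, Rmax in Ha; destruct (Rle_dec s 0);
        destruct (Rle_dec s _) in Ha; lra.
    - apply Derive_correct, D1.
    - apply Z. }
  assert (E2 : Derive (fun b => u s b) t = 0).
  { assert (Ht0 : t <> 0) by (intros ->; rewrite Rabs_R0 in Ht; lra).
    (* The segment from [t] to [2 * t] leads away from 0, so it stays where [T < |b|]. *)
    apply (is_derive_eq_on_segment (fun b => u s b) (fun _ => 0) t (2 * t)).
    - lra.
    - intros b Hb; apply Hu; [exact Hs |].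
      unfold Rmin, Rmax in Hb; unfold Rabs in *.
      destruct (Rcase_abs t), (Rcase_abs b), (Rle_dec t (2 * t)); lra.
    - apply Derive_correct, D2.
    - apply Z. }
  unfold Qdensity; rewrite E1, E2, (Hu s t Hs Ht); unfold Rdiv; ring.
Qed.

(** The hypothesis says that the one-dimensional form is negative on [cos (b s)]. *)
Lemma circular_section_unstable (r m s0 gamma eN delta k b : R) :
  0 < r -> 0 < s0 -> 0 < gamma < PI -> eN = 1 \/ eN = -1 ->
  (forall t, sff_conormal eN (circular_section r m) 1 s0 t = delta / r /\
             sff_conormal eN (circular_section r m) (-1) (- s0) t = delta / r) ->
  (b ^ 2 - 1) * RInt (fun s => cos (b * s) ^ 2) (- s0) s0
    - 2 * cos (b * s0) * (b * sin (b * s0)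
        + (r * k + delta * cos gamma) / sin gamma * cos (b * s0)) < 0 ->
  unstable eN (circular_section r m) s0 gamma k k.
Proof.
  intros Hr Hs0 Hg HN HA Hneg Hst.
  set (kappa := (r * k + delta * cos gamma) / sin gamma) in *.
  set (A := RInt (fun s => cos (b * s) ^ 2) (- s0) s0) in *.
  destruct (elementary_derive _ odd_bump_elementary) as [dphi [Hel Hdphi]].
  set (P := RInt (fun y => odd_bump y ^ 2) (- 1) 1).
  set (P' := RInt (fun y => dphi y ^ 2) (- 1) 1).
  assert (HP : 0 < P) by apply odd_bump_sq_integral_pos.
  assert (Helsq : forall f, elementary f -> elementary (fun y => f y ^ 2)).
  { intros f Hf; apply (elementary_mult f (fun y => f y * 1));
      [exact Hf | apply elementary_mult; [exact Hf | constructor]]. }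
  assert (Hcb : elementary (fun s => cos (b * s))).
  { apply (elementary_comp cos); [| apply elementary_mult]; constructor. }
  assert (IP : is_RInt (fun y => odd_bump y ^ 2) (- 1) 1 P).
  { apply (RInt_correct (V := R_CompleteNormedModule)), ex_RInt_continuous_R.
    intros; apply elementary_continuous, Helsq, odd_bump_elementary. }
  assert (IP' : is_RInt (fun y => dphi y ^ 2) (- 1) 1 P').
  { apply (RInt_correct (V := R_CompleteNormedModule)), ex_RInt_continuous_R.
    intros; apply elementary_continuous, Helsq, Hel. }
  assert (IA : is_RInt (fun s => cos (b * s) ^ 2) (- s0) s0 A).
  { apply (RInt_correct (V := R_CompleteNormedModule)), ex_RInt_continuous_R.
    intros; apply elementary_continuous, (Helsq _ Hcb). }
  assert (HP' : 0 <= P').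
  { apply RInt_ge_0; [lra | exists P'; exact IP' | intros; apply pow2_ge_0]. }
  assert (HA0 : 0 <= A).
  { apply RInt_ge_0; [lra | exists A; exact IA | intros; apply pow2_ge_0]. }
  (* [G] is the integral of [f'^2 - f^2] for [f(s) = cos (b s)]: the integrand is [(b^2 - 1) f^2]
     plus the derivative [dV] of [f f']. *)
  set (G := (b ^ 2 - 1) * A - 2 * b * sin (b * s0) * cos (b * s0)).
  assert (IG : is_RInt (fun s => b ^ 2 * sin (b * s) ^ 2 - cos (b * s) ^ 2)
                 (- s0) s0 G).
  { set (dV := fun s => b ^ 2 * sin (b * s) ^ 2 - b ^ 2 * cos (b * s) ^ 2).
    assert (IV : is_RInt dV (- s0) s0 (- 2 * b * sin (b * s0) * cos (b * s0))).
    { replace (- 2 * b * sin (b * s0) * cos (b * s0)) with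
        (- b * sin (b * s0) * cos (b * s0) - - b * sin (b * - s0) * cos (b * - s0)).
      - apply (is_RInt_derive (V := R_CompleteNormedModule)
          (fun s => - b * sin (b * s) * cos (b * s))).
        + intros s _; unfold dV; auto_derive; auto; ring.
        + intros s _; apply (ex_derive_continuous dV); unfold dV; auto_derive; auto.
      - rewrite <- Ropp_mult_distr_r, sin_neg, cos_neg; ring. }
    apply (is_RInt_ext (fun s => (b ^ 2 - 1) * cos (b * s) ^ 2 + 1 * dV s)).
    - intros s _; unfold dV; simpl; ring.
    - replace G with ((b ^ 2 - 1) * A + 1 * (- 2 * b * sin (b * s0) * cos (b * s0)))
        by (unfold G; ring).
      apply is_RInt_lin; assumption. }
  set (c := cos (b * s0)) in *.
  set (q := kappa / r).
  (* [K] is the one-dimensional form on [cos (b s)] divided by [r], hence negative by [Hneg]. *)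
  set (K := G / r - 2 * q * c ^ 2).
  assert (HK : K < 0).
  { replace K with (((b ^ 2 - 1) * A - 2 * c * (b * sin (b * s0) + kappa * c)) / r)
      by (unfold K, q, G; field; lra).
    apply Rmult_lt_reg_r with r; [exact Hr |].
    unfold Rdiv; rewrite Rmult_assoc, Rinv_l by lra; lra. }
  set (N := - (P * K)); set (M := r * A * P').
  assert (HNp : 0 < N) by (unfold N; nra).
  assert (HM : 0 <= M) by (unfold M; apply Rmult_le_pos; [nra | exact HP']).
  assert (HNM : 0 < N / (M + 1)) by (apply Rdiv_lt_0_compat; lra).
  (* With this choice [e^2 M = N M / (M + 1) < N]; the added 1 allows [M = 0]. *)
  set (e := sqrt (N / (M + 1))).
  assert (He : 0 < e) by (apply sqrt_lt_R0, HNM).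
  assert (He2 : e ^ 2 * M < N).
  { unfold e; rewrite pow2_sqrt by lra.
    apply Rmult_lt_reg_r with (M + 1); [lra |].
    replace (N / (M + 1) * M * (M + 1)) with (N * M) by (field; lra); nra. }
  pose proof (Rinv_0_lt_compat _ He) as Hie.
  set (u := fun s t => cos (b * s) * odd_bump (e * t)).
  assert (Hsm : forall n s t, ex_diff_n u n s t).
  { intros n s t; apply (elementary_ex_diff_n _ (fun t => odd_bump (e * t)) n s t Hcb).
    apply (elementary_comp odd_bump); [apply odd_bump_elementary |].
    apply elementary_mult; constructor. }
  assert (Hphi0 : forall t, / e < Rabs t -> odd_bump (e * t) = 0).
  { intros t Ht; apply odd_bump_support.
    rewrite Rabs_mult, Rabs_right by lra.
    apply Rmult_lt_compat_l with (r := e) in Ht; [| exact He].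
    rewrite Rinv_r in Ht; lra. }
  assert (Hsupp : forall s t, - s0 <= s <= s0 -> / e < Rabs t -> u s t = 0).
  { intros s t _ Ht; unfold u; rewrite Hphi0 by exact Ht; ring. }
  assert (Htest : test_function s0 u) by (split; [exact Hsm | exists (/ e); exact Hsupp]).
  (* The integral separates, and its [t] factor is the integral of an odd function. *)
  assert (Hmean : surface_integral (circular_section r m) s0 u = 0).
  { rewrite circular_section_surface_integral by exact Hr.
    set (C := RInt (fun s => cos (b * s)) (- s0) s0).
    assert (IC : is_RInt (fun s => cos (b * s)) (- s0) s0 C).
    { apply (RInt_correct (V := R_CompleteNormedModule)), ex_RInt_continuous_R.
      intros; apply elementary_continuous, Hcb. }
    replace (fun t => RInt (fun s => u s t * r) (- s0) s0)
      with (fun t => r * C * odd_bump (e * t)).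
    - apply RInt_gen_compact_support with (/ e).
      + intros t Ht; rewrite Hphi0 by exact Ht; ring.
      + replace 0 with (r * C * (/ e * 0)) by ring.
        apply (is_RInt_scal (V := R_NormedModule)).
        apply is_RInt_rescale; [exact He |].
        rewrite <- (RInt_odd odd_bump 1).
        * apply (RInt_correct (V := R_CompleteNormedModule)), ex_RInt_continuous_R.
          intros; apply elementary_continuous, odd_bump_elementary.
        * intros; apply elementary_continuous, odd_bump_elementary.
        * apply odd_bump_opp.
      + lra.
    - apply functional_extensionality; intros t; symmetry; apply is_RInt_unique.
      apply (is_RInt_ext (fun s => (r * odd_bump (e * t)) * cos (b * s))).
      + intros s _; unfold u; simpl; ring.
      + replace (r * C * odd_bump (e * t)) with (r * odd_bump (e * t) * C) by ring.
        apply (is_RInt_scal (V := R_NormedModule)), IC. }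
  specialize (Hst u Htest Hmean); revert Hst; apply Rlt_not_le.
  rewrite (circular_section_Qform r m s0 gamma eN delta k u Hr Hg HN HA).
  fold kappa; fold q.
  assert (Hdens : forall s t, Qdensity r u s t =
    odd_bump (e * t) ^ 2 / r * (b ^ 2 * sin (b * s) ^ 2 - cos (b * s) ^ 2)
    + r * e ^ 2 * dphi (e * t) ^ 2 * cos (b * s) ^ 2).
  { intros s t; unfold Qdensity.
    replace (Derive (fun a => u a t) s) with (- b * sin (b * s) * odd_bump (e * t)).
    2:{ symmetry; apply is_derive_unique; unfold u; auto_derive; auto; ring. }
    replace (Derive (fun y => u s y) t) with (cos (b * s) * (e * dphi (e * t))).
    2:{ symmetry; apply is_derive_unique; unfold u; apply is_derive_scal.
        apply (is_derive_comp odd_bump (fun t => e * t)); [apply Hdphi |].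
        auto_derive; auto; ring. }
    unfold u; field; lra. }
  assert (Hinner : forall t, RInt (fun s => Qdensity r u s t) (- s0) s0 =
    G / r * odd_bump (e * t) ^ 2 + r * e ^ 2 * A * dphi (e * t) ^ 2).
  { intros t; apply is_RInt_unique.
    apply (is_RInt_ext (fun s =>
      odd_bump (e * t) ^ 2 / r * (b ^ 2 * sin (b * s) ^ 2 - cos (b * s) ^ 2)
      + r * e ^ 2 * dphi (e * t) ^ 2 * cos (b * s) ^ 2)).
    - intros s _; symmetry; apply Hdens.
    - replace (G / r * odd_bump (e * t) ^ 2 + r * e ^ 2 * A * dphi (e * t) ^ 2)
        with (odd_bump (e * t) ^ 2 / r * G + r * e ^ 2 * dphi (e * t) ^ 2 * A)
        by (field; lra).
      apply is_RInt_lin; assumption. }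
  pose proof (is_RInt_rescale _ e P He IP) as IPe.
  pose proof (is_RInt_rescale _ e P' He IP') as IPe'.
  assert (HQ1 : RInt_gen (fun t => RInt (fun s => Qdensity r u s t) (- s0) s0)
    (Rbar_locally m_infty) (Rbar_locally p_infty)
    = G / r * (/ e * P) + r * e ^ 2 * A * (/ e * P')).
  { apply RInt_gen_compact_support with (/ e); [| | lra].
    (* [dphi] is given only as the derivative of the bump, so the vanishing of the density is
       obtained from the support of [u]. *)
    - intros t Ht; apply is_RInt_unique.
      apply is_RInt_zero; intros s Hs.
      rewrite Rmin_left, Rmax_right in Hs by lra.
      apply (Qdensity_support r s0 (/ e)); auto; lra.
    - apply (is_RInt_ext (fun t =>
        G / r * odd_bump (e * t) ^ 2 + r * e ^ 2 * A * dphi (e * t) ^ 2)).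
      + intros t _; symmetry; apply Hinner.
      + apply (is_RInt_lin (fun t => odd_bump (e * t) ^ 2) (fun t => dphi (e * t) ^ 2));
          assumption. }
  assert (HQ2 : forall s, cos (b * s) = c ->
    RInt_gen (fun t => q * u s t ^ 2) (Rbar_locally m_infty) (Rbar_locally p_infty)
    = q * c ^ 2 * (/ e * P)).
  { intros s Hs; apply RInt_gen_compact_support with (/ e); [| | lra].
    - intros t Ht; unfold u; rewrite Hphi0 by exact Ht; ring.
    - apply (is_RInt_ext (fun t => q * c ^ 2 * odd_bump (e * t) ^ 2)).
      + intros t _; unfold u; rewrite Hs; simpl; ring.
      + apply (is_RInt_scal (V := R_NormedModule)), IPe. }
  rewrite HQ1, (HQ2 s0 eq_refl), (HQ2 (- s0)).
  2:{ unfold c; rewrite <- Ropp_mult_distr_r; apply cos_neg. }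
  (* Stretching multiplies each [t] integral by [1 / e]; only the [u_t^2] term carries an extra
     [e^2]. *)
  replace (_ - _) with (/ e * (e ^ 2 * M - N)) by (unfold M, N, K; ring).
  nra.
Qed.

(** The bound [beta * s0 < PI / 2] keeps [cos (beta s)] positive on the segment, so its logarithmic
    derivative is finite there. As [w] is odd, the boundary values of [w f^2] contribute the same
    coefficient [beta tan (beta s0)] at both ends. *)
Lemma robin_inequality (f df : R -> R) (s0 beta : R) :
  0 < s0 -> 1 <= beta -> beta * s0 < PI / 2 ->
  (forall s, is_derive f s (df s)) -> (forall s, continuous df s) ->
  - (beta * tan (beta * s0)) * (f s0 ^ 2 + f (- s0) ^ 2)
    <= RInt (fun s => df s ^ 2 - f s ^ 2) (- s0) s0.
Proof.
  intros Hs0 Hb Hbs Hf Hdf.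
  assert (Hcf : forall s, continuous f s).
  { intros s; apply @ex_derive_continuous; exists (df s); apply Hf. }
  assert (Hcos : forall s, - s0 <= s <= s0 -> 0 < cos (beta * s)).
  { intros s Hs; apply cos_gt_0; nra. }
  set (w := fun s => beta * (sin (beta * s) / cos (beta * s))).
  (* [w] solves the Riccati equation [w' = beta^2 + w^2], hence
     [f'^2 - f^2 + (w f^2)' = (f' + w f)^2 + (beta^2 - 1) f^2]. *)
  set (dw := fun s => beta ^ 2 + w s ^ 2).
  assert (Hw : forall s, - s0 <= s <= s0 -> is_derive w s (dw s)).
  { intros s Hs; specialize (Hcos s Hs); unfold dw, w; auto_derive; [lra |].
    replace (cos (beta * s) * (cos (beta * s) * 1)) with (cos (beta * s) * cos (beta * s))
      by ring.
    field; lra. }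
  set (dV := fun s => dw s * (f s * f s) + w s * (df s * f s + f s * df s)).
  assert (IV : is_RInt dV (- s0) s0 (beta * tan (beta * s0) * (f s0 ^ 2 + f (- s0) ^ 2))).
  { replace (beta * tan (beta * s0) * (f s0 ^ 2 + f (- s0) ^ 2))
      with (w s0 * (f s0 * f s0) - w (- s0) * (f (- s0) * f (- s0))).
    - apply (is_RInt_derive (V := R_CompleteNormedModule) (fun s => w s * (f s * f s)));
        intros s Hs; rewrite Rmin_left, Rmax_right in Hs by lra.
      + apply (is_derive_mult w (fun s => f s * f s) s (dw s));
          [apply Hw, Hs | | intros; apply Rmult_comm].
        apply (is_derive_mult f f s (df s) (df s)); auto; intros; apply Rmult_comm.
      + assert (Hcw : continuous w s).
        { apply @ex_derive_continuous; exists (dw s); apply Hw, Hs. }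
        assert (Hcdw : continuous dw s).
        { unfold dw; simpl.
          apply (continuous_plus (V := R_NormedModule)); [apply continuous_const |].
          apply (continuous_mult w (fun s => w s * 1)); [exact Hcw |].
          apply (continuous_mult w (fun _ => 1)); [exact Hcw | apply continuous_const]. }
        apply (continuous_plus (V := R_NormedModule)).
        * apply (continuous_mult dw (fun s => f s * f s)); [exact Hcdw |].
          apply (continuous_mult f f); auto.
        * apply (continuous_mult w (fun s => df s * f s + f s * df s)); [exact Hcw |].
          apply (continuous_plus (V := R_NormedModule));
            [apply (continuous_mult df f) | apply (continuous_mult f df)]; auto.
    - unfold w, tan; rewrite <- Ropp_mult_distr_r, sin_neg, cos_neg.
      pose proof (Hcos s0 ltac:(lra)); field; lra. }
  (* Writing the boundary term as the integral of [- dV] reduces the claim to a pointwise comparison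
     of integrands. *)
  rewrite <- Ropp_mult_distr_l, <- (is_RInt_unique _ _ _ _ IV), <- (RInt_opp dV)
    by (eexists; exact IV).
  apply RInt_le; [lra | | |].
  - apply @ex_RInt_opp; eexists; exact IV.
  - apply ex_RInt_continuous_R; intros s; simpl.
    apply (continuous_minus (V := R_NormedModule)).
    + apply (continuous_mult df (fun s => df s * 1)); [apply Hdf |].
      apply (continuous_mult df (fun _ => 1)); [apply Hdf | apply continuous_const].
    + apply (continuous_mult f (fun s => f s * 1)); [apply Hcf |].
      apply (continuous_mult f (fun _ => 1)); [apply Hcf | apply continuous_const].
  - intros s _; unfold dV, dw, opp; simpl.
    assert (0 <= (df s + w s * f s) ^ 2) by apply pow2_ge_0.
    assert (0 <= (beta ^ 2 - 1) * f s ^ 2) by (apply Rmult_le_pos; nra).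
    nra.
Qed.

(** The inequality is proved on each line of constant [t], where [robin_inequality] applies to
    [s |-> u(s, t)], and is then integrated in [t]. No condition on the mean of [u] enters. *)
Lemma circular_section_strongly_stable (r m s0 gamma eN delta k beta : R) :
  0 < r -> 0 < s0 -> 0 < gamma < PI -> eN = 1 \/ eN = -1 ->
  (forall t, sff_conormal eN (circular_section r m) 1 s0 t = delta / r /\
             sff_conormal eN (circular_section r m) (-1) (- s0) t = delta / r) ->
  1 <= beta -> beta * s0 < PI / 2 ->
  (r * k + delta * cos gamma) / sin gamma = - (beta * tan (beta * s0)) ->
  strongly_stable eN (circular_section r m) s0 gamma k k.
Proof.
  intros Hr Hs0 Hg HN HA Hb Hbs Hk u [Hsm [T0 HT0]].
  rewrite (circular_section_Qform r m s0 gamma eN delta k u Hr Hg HN HA), Hk.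
  set (q := - (beta * tan (beta * s0)) / r).
  (* The bound [T0] on the support may be negative. *)
  set (T := Rabs T0).
  assert (HT : 0 <= T) by apply Rabs_pos.
  assert (Hsupp : forall s t, - s0 <= s <= s0 -> T < Rabs t -> u s t = 0).
  { intros s t Hs Ht; apply HT0; [exact Hs |].
    pose proof (Rle_abs T0); unfold T in Ht; lra. }
  assert (Hcu : forall s t, continuity_2d_pt u s t) by (intros s t; apply (Hsm 0%nat s t)).
  set (us := fun s t => Derive (fun a => u a t) s).
  set (ut := fun s t => Derive (fun b => u s b) t).
  assert (Hcs : forall s t, continuity_2d_pt us s t)
    by (intros s t; apply (Hsm 1%nat s t)).
  assert (Hct : forall s t, continuity_2d_pt ut s t)
    by (intros s t; apply (Hsm 1%nat s t)).
  assert (Hsq : forall v s t, continuity_2d_pt v s t ->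
    continuity_2d_pt (fun a b => v a b ^ 2) s t).
  { intros v s t Hv; apply (continuity_2d_pt_mult v (fun a b => v a b * 1)); [exact Hv |].
    apply (continuity_2d_pt_mult v (fun _ _ => 1));
      [exact Hv | apply continuity_2d_pt_const]. }
  assert (HcQ : forall s t, continuity_2d_pt (Qdensity r u) s t).
  { intros s t; unfold Qdensity, Rdiv; apply continuity_2d_pt_plus.
    - apply (continuity_2d_pt_mult (fun a b => us a b ^ 2 - u a b ^ 2) (fun _ _ => / r));
        [| apply continuity_2d_pt_const].
      apply continuity_2d_pt_minus; apply Hsq; auto.
    - apply (continuity_2d_pt_mult (fun _ _ => r) (fun a b => ut a b ^ 2));
        [apply continuity_2d_pt_const | apply Hsq; auto]. }
  set (G := fun t => RInt (fun s => Qdensity r u s t) (- s0) s0).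
  assert (HexG : ex_RInt G (- T) T).
  { apply ex_RInt_continuous_R; intros t.
    apply continuous_RInt_param; [lra | exact HcQ]. }
  assert (Hexq : forall s, ex_RInt (fun t => q * u s t ^ 2) (- T) T).
  { intros s; apply ex_RInt_continuous_R; intros t.
    apply (continuity_2d_pt_slice_r (fun a b => q * u a b ^ 2)).
    apply (continuity_2d_pt_mult (fun _ _ => q) (fun a b => u a b ^ 2));
      [apply continuity_2d_pt_const | apply Hsq; auto]. }
  assert (Hgenq : forall s, - s0 <= s <= s0 ->
    RInt_gen (fun t => q * u s t ^ 2) (Rbar_locally m_infty) (Rbar_locally p_infty)
    = RInt (fun t => q * u s t ^ 2) (- T) T).
  { intros s Hs; apply RInt_gen_compact_support with T; [| | exact HT].
    - intros t Ht; rewrite Hsupp by assumption; ring.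
    - apply (RInt_correct (V := R_CompleteNormedModule)), Hexq. }
  rewrite !Hgenq by lra.
  rewrite (RInt_gen_compact_support G T (RInt G (- T) T)); [| | | exact HT].
  2:{ intros t Ht; apply (is_RInt_unique (V := R_CompleteNormedModule)), is_RInt_zero.
      intros s Hs; rewrite Rmin_left, Rmax_right in Hs by lra.
      apply (Qdensity_support r s0 T); auto; lra. }
  2:{ apply (RInt_correct (V := R_CompleteNormedModule)), HexG. }
  (* The claim becomes boundary integral [<=] bulk integral, both over [[- T, T]], and the
     integrands in [t] are compared. *)
  apply Rge_le, Rge_minus, Rle_ge.
  rewrite <- (RInt_plus (V := R_CompleteNormedModule) (fun t => q * u s0 t ^ 2)) by apply Hexq.
  apply RInt_le; [lra | apply @ex_RInt_plus; apply Hexq | exact HexG |].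
  intros t _.
  assert (Hslice : forall v, (forall s t, continuity_2d_pt v s t) ->
    ex_RInt (fun s => v s t) (- s0) s0).
  { intros v Hv; apply ex_RInt_continuous_R; intros s.
    apply continuity_2d_pt_slice_l, Hv. }
  assert (Hcd : forall s t, continuity_2d_pt (fun a b => us a b ^ 2 - u a b ^ 2) s t).
  { intros s b; apply continuity_2d_pt_minus; apply Hsq; auto. }
  (* The intermediate integral drops the nonnegative term [r u_t^2]. *)
  apply Rle_trans with (RInt (fun s => / r * (us s t ^ 2 - u s t ^ 2)) (- s0) s0).
  - rewrite (RInt_scal (V := R_CompleteNormedModule)) by apply (Hslice _ Hcd).
    assert (HR : - (beta * tan (beta * s0)) * (u s0 t ^ 2 + u (- s0) t ^ 2)
                 <= RInt (fun s => us s t ^ 2 - u s t ^ 2) (- s0) s0).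
    { apply (robin_inequality (fun s => u s t) (fun s => us s t)); auto.
      - intros s; apply Derive_correct, (Hsm 1%nat s t).
      - intros s; apply continuity_2d_pt_slice_l, Hcs. }
    apply (Rmult_le_compat_l (/ r)) in HR; [| left; apply Rinv_0_lt_compat, Hr].
    eapply Rle_trans; [right | exact HR].
    unfold q, plus; simpl; field; lra.
  - apply RInt_le; [lra | | apply Hslice, HcQ |].
    + apply (Hslice (fun s t => / r * (us s t ^ 2 - u s t ^ 2))); intros a b.
      apply (continuity_2d_pt_mult (fun _ _ => / r)
        (fun a b => us a b ^ 2 - u a b ^ 2)); [apply continuity_2d_pt_const | apply Hcd].
    + intros s _; unfold Qdensity; fold (us s t); fold (ut s t).
      assert (0 <= r * ut s t ^ 2) by (apply Rmult_le_pos; [lra | apply pow2_ge_0]).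
      unfold Rdiv; lra.
Qed.

(** * Contact with a symmetric curve *)

(** The point [t] may be an endpoint of [Iv], so both sides are compared on the segment from [t] to
    [t / 2], which lies in [Iv] and avoids 0. Requiring the parity of [f] only off 0 lets the lemma
    be applied again to [Derive f]. *)
Lemma Derive_reflect (Iv : R -> Prop) (f : R -> R) (e t : R) :
  symmetric_interval Iv -> (forall t, Iv t -> t <> 0 -> f (- t) = e * f t) ->
  (forall t, Iv t -> ex_derive f t) -> Iv t -> t <> 0 ->
  Derive f (- t) = - e * Derive f t.
Proof.
  intros [Hconv Hsym] Hf Hd Ht H0.
  assert (Hhalf : forall y, Rmin t (t / 2) <= y <= Rmax t (t / 2) -> Iv y /\ y <> 0).
  { intros y Hy; unfold Rmin, Rmax in Hy; split.
    - destruct (Rlt_dec 0 t);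
        [apply (Hconv (- t) t) | apply (Hconv t (- t))]; auto;
        destruct (Rle_dec t (t / 2)); lra.
    - destruct (Rle_dec t (t / 2)); lra. }
  assert (- Derive f (- t) = e * Derive f t); [| lra].
  apply (is_derive_eq_on_segment (fun y => f (- y)) (fun y => e * f y) t (t / 2)).
  - lra.
  - intros y Hy; apply Hf; apply Hhalf, Hy.
  - rewrite <- (Rmult_1_l (Derive f (- t))), Ropp_mult_distr_l.
    apply (is_derive_comp f Ropp).
    + apply Derive_correct, Hd, Hsym, Ht.
    + auto_derive; auto; ring.
  - apply is_derive_scal, Derive_correct, Hd, Ht.
Qed.

(** With [x] odd and [z] even, [x'] and [z''] are even while [z'] and [x''] are odd; hence the
    products [x'' z'] and [z'' x'] and the speed are unchanged under reflection. *)
Lemma curve_curvature_symmetric (Iv : R -> Prop) (x z : R -> R) (eS t : R) :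
  symmetric_interval Iv -> smooth_on Iv x -> smooth_on Iv z ->
  symmetric_curve Iv x z -> Iv t -> t <> 0 ->
  curve_curvature eS x z (- t) = curve_curvature eS x z t.
Proof.
  intros HI Hx Hz Hsym Ht H0.
  assert (Dx : forall y, Iv y -> y <> 0 -> Derive x (- y) = 1 * Derive x y).
  { intros y Hy Hy0; replace 1 with (- -1) by ring.
    apply (Derive_reflect Iv); auto; [| intros w Hw; apply (Hx 1%nat w Hw)].
    intros w Hw _; rewrite (proj1 (Hsym w Hw)); ring. }
  assert (Dz : forall y, Iv y -> y <> 0 -> Derive z (- y) = -1 * Derive z y).
  { intros y Hy Hy0; replace (-1) with (Ropp 1) by ring.
    apply (Derive_reflect Iv); auto; [| intros w Hw; apply (Hz 1%nat w Hw)].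
    intros w Hw _; rewrite (proj2 (Hsym w Hw)); ring. }
  assert (Dx2 : Derive_n x 2 (- t) = -1 * Derive_n x 2 t).
  { replace (-1) with (Ropp 1) by ring.
    apply (Derive_reflect Iv (Derive x)); auto; intros w Hw; apply (Hx 2%nat w Hw). }
  assert (Dz2 : Derive_n z 2 (- t) = - -1 * Derive_n z 2 t).
  { apply (Derive_reflect Iv (Derive z)); auto; intros w Hw; apply (Hz 2%nat w Hw). }
  unfold curve_curvature, support_normal, normalize.
  rewrite Dx2, Dz2, (Dx t Ht H0), (Dz t Ht H0).
  unfold dot, co1, co2, co3, scal, opp; simpl.
  unfold prod_scal, prod_opp, scal, opp; simpl; unfold mult; simpl.
  replace (-1 * Derive z t) with (- Derive z t) by ring.
  rewrite !Rmult_1_l, !Ropp_involutive, !Rmult_1_r, !Rmult_opp_opp.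
  f_equal; ring.
Qed.

(** * The frequency equation and the stability criterion *)

Lemma robin_frequency (s0 k : R) :
  0 < s0 -> 0 < k ->
  exists beta, unique (fun b => 0 < b < PI / (2 * s0) /\ tan (b * s0) = k / b) beta.
Proof.
  intros Hs Hk; pose proof PI_RGT_0 as HPI.
  assert (Hb : 0 < PI / (2 * s0)) by (apply Rdiv_lt_0_compat; lra).
  assert (Hrange : forall b, 0 < b < PI / (2 * s0) -> 0 < b * s0 < PI / 2).
  { intros b Hb'; split; [nra |].
    replace (PI / 2) with (PI / (2 * s0) * s0) by (field; lra); nra. }
  assert (HE : PI / (2 * s0) * s0 = PI / 2) by (field; lra).
  (* Clearing denominators gives a function continuous up to both ends, unlike [tan (b s0)] and
     [k / b]; its values there are [- k] and [PI / (2 s0)]. *)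
  destruct (IVT (fun b => b * sin (b * s0) - k * cos (b * s0)) 0 (PI / (2 * s0)))
    as [beta [Hbeta H0]].
  - intros b; apply continuity_pt_filterlim.
    apply (ex_derive_continuous (fun b => b * sin (b * s0) - k * cos (b * s0))).
    auto_derive; auto.
  - exact Hb.
  - rewrite !Rmult_0_l, cos_0; lra.
  - rewrite HE, sin_PI2, cos_PI2; lra.
  - assert (Hin : 0 < beta < PI / (2 * s0)).
    { assert (beta <> 0) by (intros E; rewrite E, !Rmult_0_l, cos_0 in H0; lra).
      assert (beta <> PI / (2 * s0)) by
        (intros E; rewrite E, HE, sin_PI2, cos_PI2 in H0; lra).
      lra. }
    assert (Ht : tan (beta * s0) = k / beta).
    { pose proof (Hrange beta Hin).
      assert (0 < cos (beta * s0)) by (apply cos_gt_0; lra).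
      unfold tan; apply Rmult_eq_reg_r with (beta * cos (beta * s0)); [| nra].
      transitivity (beta * sin (beta * s0)); [field; lra |].
      transitivity (k * cos (beta * s0)); [lra | field; lra]. }
    exists beta; split; [split; [exact Hin | exact Ht] |].
    intros b' [Hb' Ht'].
    (* Uniqueness: on this interval [tan (b s0)] increases strictly while [k / b] decreases
       strictly. *)
    assert (Hmono : forall b c, 0 < b < PI / (2 * s0) -> 0 < c < PI / (2 * s0) ->
      tan (b * s0) = k / b -> tan (c * s0) = k / c -> ~ b < c).
    { intros b c B C Tb Tc Hlt.
      pose proof (Hrange b B); pose proof (Hrange c C).
      assert (tan (b * s0) < tan (c * s0)) by (apply tan_increasing; nra).
      assert (k / c < k / b).
      { apply Rmult_lt_compat_l; [exact Hk |].
        apply Rinv_lt_contravar; nra. }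
      lra. }
    pose proof (Hmono beta b' Hin Hb' Ht Ht').
    pose proof (Hmono b' beta Hb' Hin Ht' Ht); lra.
Qed.

Theorem theorem4p1
    (Iv : R -> Prop) (x z : R -> R) (r m s0 gamma tau0 delta eN eS : R)
    (D Omega : R3 -> Prop)
    (hI : symmetric_interval Iv)
    (hx : smooth_on Iv x) (hz : smooth_on Iv z)
    (hreg : regular_on Iv x z)
    (hemb : embedded_on Iv x z)
    (hsym : symmetric_curve Iv x z)
    (hr : 0 < r) (hs0 : 0 < s0 < PI) (hgamma : 0 < gamma < PI)
    (hcap : capillary Iv x z (circular_section r m) s0 gamma eN eS D Omega)
    (hmeet : forall s t, - s0 <= s <= s0 ->
       (cylinder Iv x z (circular_section r m s t) <-> s = s0 \/ s = - s0))
    (htau0 : Iv tau0)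
    (hLplus : circular_section r m s0 0 = (x tau0, 0, z tau0))
    (hLminus : circular_section r m (- s0) 0 = (x (- tau0), 0, z (- tau0)))
    (hdelta : delta = 1 \/ delta = -1)
    (hA : forall t, sff_conormal eN (circular_section r m) 1 s0 t = delta / r /\
                    sff_conormal eN (circular_section r m) (-1) (- s0) t = delta / r) :
  let X := circular_section r m in
  let kp := curve_curvature eS x z tau0 in
  let km := curve_curvature eS x z (- tau0) in
  let mu := r * kp + delta * cos gamma in
  (0 <= mu -> unstable eN X s0 gamma kp km) /\
  (mu < 0 ->
     exists beta : R,
       unique (fun b => 0 < b < PI / (2 * s0) /\
                        tan (b * s0) = - mu / (b * sin gamma)) beta /\
       (beta < 1 -> unstable eN X s0 gamma kp km) /\
       (~ beta < 1 -> strongly_stable eN X s0 gamma kp km)).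
Proof.
  intros X kp km mu.
  assert (hN : eN = 1 \/ eN = -1) by apply (cap_eN _ _ _ _ _ _ _ _ _ _ hcap).
  assert (hsin : 0 < sin gamma) by (apply sin_gt_0; lra).
  (* Symmetry forces [x 0 = 0], whereas the contact point has first coordinate [r sin s0 > 0]. *)
  assert (htau : tau0 <> 0).
  { intros E; pose proof (f_equal co1 hLplus) as Hx0.
    change (r * sin s0 = x tau0) in Hx0.
    assert (0 < sin s0) by (apply sin_gt_0; lra).
    destruct (hsym tau0 htau0) as [Hx _]; rewrite E, Ropp_0 in Hx.
    rewrite E in Hx0; nra. }
  assert (hkm : km = kp) by (apply (curve_curvature_symmetric Iv); assumption).
  rewrite hkm; split; intros hmu.
  (* With [b = 0] the profile is the constant 1, and the form equals [- 2 s0 - 2 mu / sin gamma]. *)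
  - apply (circular_section_unstable r m s0 gamma eN delta kp 0); auto; [lra |].
    fold mu.
    rewrite (RInt_ext _ (fun _ => 1)).
    2:{ intros s _; rewrite Rmult_0_l, cos_0; apply pow1. }
    rewrite RInt_const, !Rmult_0_l, cos_0.
    assert (0 <= mu / sin gamma) by (apply Rdiv_le_0_compat; lra).
    unfold scal; simpl; unfold mult; simpl; lra.
  - destruct (robin_frequency s0 (- mu / sin gamma)) as [beta [[Hb Ht] Huniq]];
      [lra | apply Rdiv_lt_0_compat; lra |].
    assert (Hquot : forall b, 0 < b ->
      - mu / (b * sin gamma) = - mu / sin gamma / b) by (intros; field; lra).
    assert (Hbs : 0 < beta * s0 < PI / 2).
    { split; [nra |].
      replace (PI / 2) with (PI / (2 * s0) * s0) by (field; lra); nra. }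
    exists beta; split; [| split].
    + split; [rewrite Hquot by lra; auto |].
      intros b [Hb' Hbt]; apply Huniq; split; [exact Hb' |].
      rewrite <- Hquot by lra; exact Hbt.
    + intros Hlt.
      apply (circular_section_unstable r m s0 gamma eN delta kp beta); auto; [lra |].
      fold mu.
      assert (Hc : 0 < cos (beta * s0)) by (apply cos_gt_0; lra).
      (* The frequency equation is the Robin condition for [cos (beta s)]: the boundary term cancels
         and only [(beta^2 - 1)] times a positive integral remains. *)
      assert (Hrobin : beta * sin (beta * s0) + mu / sin gamma * cos (beta * s0) = 0).
      { replace (sin (beta * s0)) with (tan (beta * s0) * cos (beta * s0))
          by (unfold tan; field; lra).
        rewrite Ht; field; lra. }
      rewrite Hrobin, Rmult_0_r, Rminus_0_r.
      assert (HA : 0 < RInt (fun s => cos (beta * s) ^ 2) (- s0) s0).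
      { apply RInt_gt_0; [lra | |].
        - intros s Hs; apply pow_lt, cos_gt_0; nra.
        - intros s _; apply (ex_derive_continuous (fun s => cos (beta * s) ^ 2)).
          auto_derive; auto. }
      apply Ropp_lt_cancel; rewrite Ropp_0, Ropp_mult_distr_l.
      apply Rmult_lt_0_compat; [nra | exact HA].
    + intros Hge.
      apply (circular_section_strongly_stable r m s0 gamma eN delta kp beta);
        auto; try lra.
      (* The frequency equation, solved for [mu / sin gamma], is the required boundary
         coefficient. *)
      fold mu; rewrite Ht; field; lra.
Qed.
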